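(* In the setting of the context, let $\boldsymbol{v}=(\boldsymbol{v}_{\mathrm o}^{\intercal},\boldsymbol{v}_{\mathrm e}^{\intercal})^{\intercal}:[0,1]\to\mathbb{R}^{2r}$ be a solution of $$\frac{\partial}{\partial x}\begin{pmatrix}\boldsymbol{v}_{\mathrm o}\\\boldsymbol{v}_{\mathrm e}\end{pmatrix}=\begin{pmatrix}0&\boldsymbol\Lambda_r^{-1}\tilde{\mathbf L}_{\mathrm{ee}}\\\boldsymbol\Lambda_r^{-1}\tilde{\mathbf L}_{\mathrm{oo}}&0\end{pmatrix}\begin{pmatrix}\boldsymbol{v}_{\mathrm o}\\\boldsymbol{v}_{\mathrm e}\end{pmatrix},$$ so that $$\boldsymbol{v}(x)=\sum_{j=1}^s\left(2\cosh(\tilde\lambda_jx)\begin{pmatrix}\boldsymbol r_{\mathrm oj}\boldsymbol l_{\mathrm oj}^{\intercal}\boldsymbol v_{\mathrm o}(0)\\\boldsymbol r_{\mathrm ej}\boldsymbol l_{\mathrm ej}^{\intercal}\boldsymbol v_{\mathrm e}(0)\end{pmatrix}+2\sinh(\tilde\lambda_jx)\begin{pmatrix}\boldsymbol r_{\mathrm oj}\boldsymbol l_{\mathrm ej}^{\intercal}\boldsymbol v_{\mathrm e}(0)\\\boldsymbol r_{\mathrm ej}\boldsymbol l_{\mathrm oj}^{\intercal}\boldsymbol v_{\mathrm o}(0)\end{pmatrix}\right)+\mathbf R_0\mathbf L_0^{\intercal}\boldsymbol v(0).$$ If $\boldsymbol l_{\mathrm o1}^{\intercal}\boldsymbol v_{\mathrm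 o}(0)=\boldsymbol l_{\mathrm o1}^{\intercal}\boldsymbol v_{\mathrm o}(1)=0$, then $\boldsymbol l_{\mathrm e1}^{\intercal}\boldsymbol v_{\mathrm e}(0)=\boldsymbol l_{\mathrm e1}^{\intercal}\boldsymbol v_{\mathrm e}(1)=0$; consequently the $j=1$ terms, involving $\cosh(\tilde\lambda_1x)$ and $\sinh(\tilde\lambda_1x)$, vanish from the expression $$\sum_{j=1}^s\left(2\cosh(\tilde\lambda_jx)\begin{pmatrix}\boldsymbol r_{\mathrm oj}\boldsymbol l_{\mathrm oj}^{\intercal}\boldsymbol v_{\mathrm o}(0)\\\boldsymbol r_{\mathrm ej}\boldsymbol l_{\mathrm ej}^{\intercal}\boldsymbol v_{\mathrm e}(0)\end{pmatrix}+2\sinh(\tilde\lambda_jx)\begin{pmatrix}\boldsymbol r_{\mathrm oj}\boldsymbol l_{\mathrm ej}^{\intercal}\boldsymbol v_{\mathrm e}(0)\\\boldsymbol r_{\mathrm ej}\boldsymbol l_{\mathrm oj}^{\intercal}\boldsymbol v_{\mathrm o}(0)\end{pmatrix}\right)+\mathbf R_0\mathbf L_0^{\intercal}\boldsymbol v(0)$$ of $\boldsymbol v(x)$.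
   Context: Let $\mathbf A_{\mathrm{oe}}$ be a real matrix of rank $r$, with singular value decomposition $$\mathbf A_{\mathrm{oe}}=\begin{pmatrix}\mathbf U_1&\mathbf U_2\end{pmatrix}\begin{pmatrix}\boldsymbol\Lambda_r&0\\0&0\end{pmatrix}\begin{pmatrix}\mathbf V_1^{\intercal}\\\mathbf V_2^{\intercal}\end{pmatrix},$$ where $\boldsymbol\Lambda_r=\mathrm{diag}(\lambda_1,\dots,\lambda_r)$, $\lambda_1\ge\dots\ge\lambda_r>0$. Let $\mathbf L_{\mathrm{oo}},\mathbf L_{\mathrm{ee}}$ be real symmetric negative semidefinite matrices (of sizes the number of rows and columns of $\mathbf A_{\mathrm{oe}}$, respectively) such that $\mathbf U_2^{\intercal}\mathbf L_{\mathrm{oo}}\mathbf U_2$ and $\mathbf V_2^{\intercal}\mathbf L_{\mathrm{ee}}\mathbf V_2$ are invertible, and define the $r\times r$ matrices $$\tilde{\mathbf L}_{\mathrm{oo}}=\mathbf U_1^{\intercal}\mathbf L_{\mathrm{oo}}\mathbf U_1-\mathbf U_1^{\intercal}\mathbf L_{\mathrm{oo}}\mathbf U_2(\mathbf U_2^{\intercal}\mathbf L_{\mathrm{oo}}\mathbf U_2)^{-1}\mathbf U_2^{\intercal}\mathbf L_{\mathrm{oo}}\mathbf U_1,\qquad \tilde{\mathbf L}_{\mathrm{ee}}=\mathbf V_1^{\intercal}\mathbf L_{\mathrm{ee}}\mathbf V_1-\mathbf V_1^{\intercal}\mathbf L_{\mathrm{ee}}\mathbf V_2(\mathbf V_2^{\intercal}\mathbf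 L_{\mathrm{ee}}\mathbf V_2)^{-1}\mathbf V_2^{\intercal}\mathbf L_{\mathrm{ee}}\mathbf V_1.$$ (The ODE for $\boldsymbol v_{\mathrm o}=\mathbf U_1^{\intercal}\boldsymbol u_{\mathrm o}$, $\boldsymbol v_{\mathrm e}=\mathbf V_1^{\intercal}\boldsymbol u_{\mathrm e}$ arises from the system $\mathbf A_{\mathrm{oe}}\partial_x\boldsymbol u_{\mathrm e}=\mathbf L_{\mathrm{oo}}\boldsymbol u_{\mathrm o}$, $\mathbf A_{\mathrm{oe}}^{\intercal}\partial_x\boldsymbol u_{\mathrm o}=\mathbf L_{\mathrm{ee}}\boldsymbol u_{\mathrm e}$.) It is assumed that the $2r\times2r$ matrix of the ODE has an eigenvalue decomposition $\mathbf R_r\,\mathrm{diag}(\tilde\lambda_1,-\tilde\lambda_1,\dots,\tilde\lambda_r,-\tilde\lambda_r)\,\mathbf R_r^{-1}$ with $\tilde\lambda_1\ge\dots\ge\tilde\lambda_s>0=\tilde\lambda_{s+1}=\dots=\tilde\lambda_r$, $1\le s\le r$, where $\mathbf R_r=(\mathbf R_s\ \ \mathbf R_0)$ and $$\mathbf R_s=\begin{pmatrix}\boldsymbol r_{\mathrm o1}&-\boldsymbol r_{\mathrm o1}&\cdots&\boldsymbol r_{\mathrm os}&-\boldsymbol r_{\mathrm os}\\\boldsymbol r_{\mathrm e1}&\boldsymbol r_{\mathrm e1}&\cdots&\boldsymbol r_{\mathrm es}&\boldsymbol r_{\mathrm es}\end{pmatrix}.$$ Set $\mathbf L_r^{\intercal}=\mathbf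 R_r^{-1}$, $\mathbf L_r=(\mathbf L_s\ \ \mathbf L_0)$, which correspondingly has $$\mathbf L_s=\begin{pmatrix}\boldsymbol l_{\mathrm o1}&-\boldsymbol l_{\mathrm o1}&\cdots&\boldsymbol l_{\mathrm os}&-\boldsymbol l_{\mathrm os}\\\boldsymbol l_{\mathrm e1}&\boldsymbol l_{\mathrm e1}&\cdots&\boldsymbol l_{\mathrm es}&\boldsymbol l_{\mathrm es}\end{pmatrix}.$$ *)

(* Defs.v *)
From HB Require Import structures.
From mathcomp Require Import all_boot all_order all_algebra.
From mathcomp Require Import all_classical all_reals all_analysis.
Import Order.TTheory GRing.Theory Num.Theory.
Import numFieldNormedType.Exports.

Set Implicit Arguments.
Unset Strict Implicit.
Unset Printing Implicit Defensive.

Local Open Scope classical_set_scope.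
Local Open Scope ring_scope.

Definition cosh (R : realType) (x : R) : R := (expR x + expR (- x)) / 2.
Definition sinh (R : realType) (x : R) : R := (expR x - expR (- x)) / 2.

(* [m] and [n] may be equal only propositionally (such as [r + r] and
   [s.*2 + (r - s).*2] for [s <= r]), where [invmx] would require a cast. *)
Definition inverse_mx (R : realType) (m n : nat)
    (A : 'M[R]_(m, n)) (B : 'M[R]_(n, m)) : Prop :=
  A *m B = 1%:M /\ B *m A = 1%:M.

Definition orthogonal_mx (R : realType) (m n : nat) (U : 'M[R]_(m, n)) : Prop :=
  inverse_mx U U^T.

Definition neg_semidef (R : realType) (n : nat) (L : 'M[R]_n) : Prop :=
  L^T = L /\ forall x : 'cV[R]_n, (x^T *m L *m x) 0 0 <= 0.

Definition svd (R : realType) (m n r : nat) (A : 'M[R]_(m, n))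
    (U1 : 'M[R]_(m, r)) (U2 : 'M[R]_(m, m - r)) (lambda : 'rV[R]_r)
    (V1 : 'M[R]_(n, r)) (V2 : 'M[R]_(n, n - r)) : Prop :=
  [/\ orthogonal_mx (row_mx U1 U2),
      orthogonal_mx (row_mx V1 V2),
      (forall i j : 'I_r, (i <= j)%N -> lambda 0 j <= lambda 0 i),
      (forall i : 'I_r, 0 < lambda 0 i) &
      A = row_mx U1 U2 *m block_mx (diag_mx lambda) 0 0 0
            *m col_mx V1^T V2^T].

Definition tilde_mx (R : realType) (m r p : nat) (L : 'M[R]_m)
    (U1 : 'M[R]_(m, r)) (U2 : 'M[R]_(m, p)) : 'M[R]_r :=
  U1^T *m L *m U1
    - U1^T *m L *m U2 *m invmx (U2^T *m L *m U2) *m (U2^T *m L *m U1).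

Definition ode_mx (R : realType) (r : nat) (lambda : 'rV[R]_r)
    (tLoo tLee : 'M[R]_r) : 'M[R]_(r + r) :=
  block_mx 0 (invmx (diag_mx lambda) *m tLee)
           (invmx (diag_mx lambda) *m tLoo) 0.

Lemma half_ord_subproof (s : nat) (k : 'I_(s.*2)) : (k./2 < s)%N.
Proof. by rewrite ltn_half_double. Qed.

Definition half_ord (s : nat) (k : 'I_(s.*2)) : 'I_s :=
  Ordinal (half_ord_subproof k).

Lemma double_ord_subproof (s : nat) (j : 'I_s) : (j.*2 < s.*2)%N.
Proof. by rewrite ltn_double. Qed.

Definition double_ord (s : nat) (j : 'I_s) : 'I_(s.*2) :=
  Ordinal (double_ord_subproof j).

(* Columns a_1, b_1, ..., a_s, b_s. *)
Definition interleave (R : realType) (m s : nat)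
    (a b : 'M[R]_(m, s)) : 'M[R]_(m, s.*2) :=
  \matrix_(i, k) (if odd k then b else a) i (half_ord k).

(* The shape shared by R_s and L_s: the columns of [o] and [e] are the vectors
   r_{oj}, r_{ej} (respectively l_{oj}, l_{ej}). *)
Definition paired_cols (R : realType) (r s : nat)
    (o e : 'M[R]_(r, s)) : 'M[R]_(r + r, s.*2) :=
  interleave (col_mx o e) (col_mx (- o) e).

(* The first column of each of the s consecutive pairs of columns. *)
Definition first_cols (R : realType) (m s : nat)
    (M : 'M[R]_(m, s.*2)) : 'M[R]_(m, s) :=
  colsub (@double_ord s) M.

(* (mu_1, -mu_1, mu_2, -mu_2, ...), with mu_{j+1} encoded as [mu j]. *)
Definition signed_pairs (R : realType) (n : nat) (mu : nat -> R) : 'rV[R]_n :=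
  \row_(k < n) ((-1) ^+ k * mu k./2).

(* Continuity on [a, b] and the equation on ]a, b[ already imply the one-sided
   equations at the endpoints. *)
Definition linear_ode_solution (R : realType) (n : nat) (M : 'M[R]_n)
    (a b : R) (v : R -> 'cV[R]_n) : Prop :=
  {within `[a, b], continuous v} /\
  forall x : R, x \in `]a, b[ -> is_derive x 1 v (M *m v x).

Definition cosh_term (R : realType) (r s : nat) (mu : nat -> R)
    (Ro Re Lo Le : 'M[R]_(r, s)) (vo0 ve0 : 'cV[R]_r) (j : 'I_s) (x : R) :
    'cV[R]_(r + r) :=
  (2 * cosh (mu j * x)) *:
    col_mx (col j Ro *m ((col j Lo)^T *m vo0))
           (col j Re *m ((col j Le)^T *m ve0)).

Definition sinh_term (R : realType) (r s : nat) (mu : nat -> R)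
    (Ro Re Lo Le : 'M[R]_(r, s)) (vo0 ve0 : 'cV[R]_r) (j : 'I_s) (x : R) :
    'cV[R]_(r + r) :=
  (2 * sinh (mu j * x)) *:
    col_mx (col j Ro *m ((col j Le)^T *m ve0))
           (col j Re *m ((col j Lo)^T *m vo0)).

(* Main.v *)
Require Import Defs.
From HB Require Import structures.
From mathcomp Require Import all_boot all_order all_algebra.
From mathcomp Require Import all_classical all_reals all_analysis.
From mathcomp Require Import ring.
Import Order.TTheory GRing.Theory Num.Theory.
Import numFieldNormedType.Exports.
Local Open Scope ring_scope.

Set Implicit Arguments.
Unset Strict Implicit.
Unset Printing Implicit Defensive.

(* The rows of the inverse eigenvector matrix are left eigenvectors, so the
   coordinates of a solution in the eigenbasis evolve as independent scalar
   exponentials. The ODE matrix is block antidiagonal, hence anticommutes with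
   diag(-1, 1), which exchanges the eigenvalues [mu j] and [- mu j]; this gives
   the left eigenvectors the same paired shape as the right ones, and each pair
   of exponentials recombines into cosh and sinh. If l_o1^T v_o vanishes at 0
   and 1, both coordinates of the first pair equal l_e1^T v_e at these points;
   so l_e1^T v_e(1) is l_e1^T v_e(0) times exp(mu 0) and also times
   exp(- mu 0), which forces it to be 0. *)

(** * Solutions of diagonalised linear differential equations *)

Lemma mulmx_coord_continuous (R : realType) (m n : nat) (Q : 'M[R]_(m, n))
    (k : 'I_m) :
  continuous (fun w : 'cV[R]_n => (Q *m w) k 0).
Proof.
have -> : (fun w : 'cV[R]_n => (Q *m w) k 0)
        = (fun w => \sum_(j < n) Q k j * w j 0).
  by apply/funext => w; rewrite mxE.
apply: continuous_big => [|j _]; first exact: add_continuous.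
by move=> w; apply: continuousM; [exact: cst_continuous|exact: coord_continuous].
Qed.

Lemma is_derive_mulmx_coord (R : realType) (m n : nat) (Q : 'M[R]_(m, n))
    (k : 'I_m) (v : R -> 'cV[R]_n) (dv : 'cV[R]_n) (x : R) :
  is_derive x 1 v dv -> is_derive x 1 (fun t => (Q *m v t) k 0) ((Q *m dv) k 0).
Proof.
move=> hv; have /derivable_mxP vD := @ex_derive _ _ _ _ _ _ _ hv.
have vij j : is_derive x 1 (fun t => v t j 0) (dv j 0).
  apply: DeriveDef; first exact: vD.
  have <- := @derive_val _ _ _ _ _ _ _ hv.
  by rewrite derive_mx ?mxE //; exact: ex_derive.
have -> : (fun t => (Q *m v t) k 0)
        = \sum_(j < n) (Q k j \*: (fun t => v t j 0)).
  by apply/funext => t; rewrite mxE fct_sumE.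
have -> : (Q *m dv) k 0 = \sum_(j < n) Q k j *: dv j 0 by rewrite mxE.
by apply: is_derive_sum => j; exact: is_deriveZ.
Qed.

(** Integrating factor: the product of [g] with [expR (- c * t)] has zero derivative, so by the mean
    value theorem on [a, x] it takes the same value at [a] and [x]. *)
Lemma scalar_linear_ode_solution (R : realType) (c a b : R) (g : R -> R) :
  {within `[a, b], continuous g}%classic ->
  (forall x, x \in `]a, b[ -> is_derive x 1 g (c * g x)) ->
  forall x, x \in `[a, b] -> g x = expR (c * (x - a)) * g a.
Proof.
move=> gC gD x /[!in_itv]/= /andP[ax xb].
pose E (t : R) := expR (- c * t).
have ED (t : R) : is_derive t 1 E (- c * E t).
  have h : is_derive t 1 ( *%R (- c)) (- c).
    have -> : ( *%R (- c)) = (- c) \*: (@id R) by [].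
    by apply: is_derive_eq; rewrite /GRing.scale /= mulr1.
  by rewrite mulrC; exact: (is_derive1_comp (f := expR) (g := *%R (- c))).
have EC : continuous E.
  by move=> t; apply/differentiable_continuous/derivable1_diffP; exact: ex_derive.
have [|| y _] := @MVT_segment _ (E * g) (cst 0) _ _ ax.
- move=> t /[!in_itv]/= /andP[xt tx].
  have gDt : is_derive t 1 g (c * g t).
    by apply: gD; rewrite in_itv /= xt (lt_le_trans tx).
  apply: is_derive_eq.
  by change (E t * (c * g t) + g t * (- c * E t) = 0 :> R); ring.
- have sub : (`[a, x] `<=` `[a, b])%classic.
    by apply: subset_itvl; rewrite bnd_simp.
  have gx := continuous_subspaceW sub gC.
  move=> t; apply: (@continuousM _ _ (E : subspace _ -> R) g).
    exact: (continuous_subspaceT EC).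
  exact: gx.
rewrite mul0r => /eqP; rewrite subr_eq0 => /eqP h.
have {}h : E x * g x = E a * g a by [].
have : expR (c * x) * (E x * g x) = expR (c * x) * (E a * g a) by rewrite h.
rewrite !mulrA /E -!expRD mulNr subrr expR0 mul1r => ->.
by rewrite mulrBr mulNr.
Qed.

Lemma diag_linear_ode_solution (R : realType) (m n : nat) (M : 'M[R]_m)
    (P : 'M[R]_(m, n)) (Q : 'M[R]_(n, m)) (d : 'rV[R]_n) (a b : R)
    (v : R -> 'cV[R]_m) :
  Q *m P = 1%:M -> M = P *m diag_mx d *m Q ->
  linear_ode_solution M a b v ->
  forall x, x \in `[a, b] ->
    Q *m v x = diag_mx (map_mx (fun c => expR (c * (x - a))) d) *m (Q *m v a).
Proof.
move=> QP ME [vC vD] x xab.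
apply/matrixP => k j; rewrite ord1 {j} mul_diag_mx [RHS]mxE [X in X * _]mxE.
apply: (@scalar_linear_ode_solution _ (d 0 k) a b
         (fun t => (Q *m v t) k 0)) => //.
- apply: (@within_continuous_comp _ _ _ _ v (fun w => (Q *m w) k 0)) => //.
  by move=> w _; exact: mulmx_coord_continuous.
- move=> t /vD vt.
  have := is_derive_mulmx_coord Q k vt.
  (* From [Q *m P = 1%:M], the row [k] of [Q] is a left eigenvector of [M] for [d 0 k]. *)
  rewrite ME !mulmxA QP mul1mx -mulmxA mul_diag_mx.
  by rewrite [X in is_derive _ _ _ X]mxE.
Qed.

(** * Indexing of consecutive pairs of columns *)

Lemma pair_ord_subproof (s : nat) (b : bool) (j : 'I_s) : (b + j.*2 < s.*2)%N.
Proof. by case: b; rewrite ?add1n ?ltn_Sdouble ?add0n ?ltn_double. Qed.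

(** The boolean selects the member of pair [j]: [false] goes with the eigenvalue [mu j], [true] with
    [- mu j]. *)
Definition pair_ord (s : nat) (b : bool) (j : 'I_s) : 'I_(s.*2) :=
  Ordinal (pair_ord_subproof b j).

Lemma half_pair_ord (s : nat) (b : bool) (j : 'I_s) :
  half_ord (pair_ord b j) = j.
Proof. by apply/val_inj; rewrite /= half_bit_double. Qed.

Lemma odd_pair_ord (s : nat) (b : bool) (j : 'I_s) : odd (pair_ord b j) = b.
Proof. by rewrite /= oddD odd_double addbF oddb. Qed.

Lemma pair_ord_half (s : nat) (k : 'I_(s.*2)) :
  pair_ord (odd k) (half_ord k) = k.
Proof. by apply/val_inj; rewrite /= odd_double_half. Qed.

Lemma sum_pair_ord (V : nmodType) (s : nat) (F : 'I_(s.*2) -> V) :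
  \sum_k F k = \sum_(j < s) (F (pair_ord false j) + F (pair_ord true j)).
Proof.
rewrite (reindex (fun p : 'I_s * bool => pair_ord p.2 p.1)) /=; last first.
  exists (fun k => (half_ord k, odd k)) => [[j b]|k] _.
    by rewrite half_pair_ord odd_pair_ord.
  by rewrite pair_ord_half.
rewrite -(pair_bigA _ (fun j b => F (pair_ord b j))).
by apply: eq_bigr => j _; rewrite big_bool addrC.
Qed.

Definition swap_ord (s : nat) (k : 'I_(s.*2)) : 'I_(s.*2) :=
  pair_ord (~~ odd k) (half_ord k).

Lemma swap_pair_ord (s : nat) (b : bool) (j : 'I_s) :
  swap_ord (pair_ord b j) = pair_ord (~~ b) j.
Proof. by rewrite /swap_ord odd_pair_ord half_pair_ord. Qed.

Lemma swap_ordK (s : nat) : involutive (@swap_ord s).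
Proof. by move=> k; rewrite {2}/swap_ord swap_pair_ord negbK pair_ord_half. Qed.

Lemma eq_col_pair_ord (R : realType) (m s : nat) (A B : 'M[R]_(m, s.*2)) :
  (forall b j, col (pair_ord b j) A = col (pair_ord b j) B) -> A = B.
Proof.
move=> AB; apply/matrixP => i k.
by have /matrixP/(_ i 0) := AB (odd k) (half_ord k); rewrite !mxE pair_ord_half.
Qed.

Lemma col_interleave (R : realType) (m s : nat) (A B : 'M[R]_(m, s))
    (b : bool) (j : 'I_s) :
  col (pair_ord b j) (interleave A B) = col j (if b then B else A).
Proof.
by apply/matrixP => i l; rewrite !mxE odd_pair_ord half_pair_ord; case: b.
Qed.

Lemma col_first_cols (R : realType) (m s : nat) (A : 'M[R]_(m, s.*2))
    (j : 'I_s) :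
  col j (first_cols A) = col (pair_ord false j) A.
Proof. by apply/matrixP => i l; rewrite !mxE; congr (A i _); exact: val_inj. Qed.

(** * The flip symmetry and the shape of the left eigenvectors *)

Definition flip_mx (R : realType) (r : nat) : 'M[R]_(r + r) :=
  block_mx (- 1%:M) 0 0 1%:M.

Lemma tr_flip_mx (R : realType) (r : nat) : (flip_mx R r)^T = flip_mx R r.
Proof. by rewrite /flip_mx tr_block_mx linearN /= !trmx1 !trmx0. Qed.

Lemma flip_mx_col (R : realType) (r n : nat) (o e : 'M[R]_(r, n)) :
  flip_mx R r *m col_mx o e = col_mx (- o) e.
Proof.
by rewrite /flip_mx mul_block_col mulNmx !mul1mx !mul0mx addr0 add0r.
Qed.

Lemma flip_mx_antidiag (R : realType) (r : nat) (B C : 'M[R]_r) :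
  flip_mx R r *m block_mx 0 B C 0 = - (block_mx 0 B C 0 *m flip_mx R r).
Proof.
rewrite /flip_mx !mulmx_block opp_block_mx !mulNmx !mulmxN.
by rewrite !mul1mx !mulmx1 !mul0mx !mulmx0 !addr0 !add0r !oppr0 opprK.
Qed.

Lemma flip_paired_cols (R : realType) (r s : nat) (o e : 'M[R]_(r, s)) :
  flip_mx R r *m paired_cols o e = colsub (@swap_ord s) (paired_cols o e).
Proof.
apply: eq_col_pair_ord => b j.
rewrite colE -mulmxA -colE col_interleave.
rewrite [RHS](_ : _ = col (swap_ord (pair_ord b j)) (paired_cols o e)); last first.
  by apply/matrixP => i l; rewrite !mxE.
rewrite swap_pair_ord col_interleave.
by case: b; rewrite !col_col_mx flip_mx_col ?linearN ?opprK.
Qed.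

(* [flip_mx] maps ker [M], the span of the columns of [R0], to itself; hence
   flipping [Ls] and swapping the columns of each pair yields a matrix that is
   again dual to [Rs] and vanishes on [R0], so it is [Ls] itself. *)
Lemma paired_cols_dual (R : realType) (r s k : nat) (M : 'M[R]_(r + r))
    (Rs Ls : 'M[R]_(r + r, s.*2)) (R0 L0 : 'M[R]_(r + r, k))
    (d : 'rV[R]_(s.*2)) (Ro Re Lo Le : 'M[R]_(r, s)) :
  inverse_mx (row_mx Rs R0) (row_mx Ls L0)^T ->
  (forall i, d 0 i != 0) ->
  M = Rs *m diag_mx d *m Ls^T ->
  flip_mx R r *m M = - (M *m flip_mx R r) ->
  Rs = paired_cols Ro Re -> first_cols Ls = col_mx Lo Le ->
  Ls = paired_cols Lo Le.
Proof.
set J := flip_mx R r => -[PQ QP] d0 ME JM RsE LsE.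
have [LR LR0 _ _] : [/\ Ls^T *m Rs = 1%:M, Ls^T *m R0 = 0,
    L0^T *m Rs = 0 & L0^T *m R0 = 1%:M].
  by apply: eq_block_mx; rewrite -scalar_mx_block -QP tr_row_mx mul_col_row.
have LM : Ls^T *m M = diag_mx d *m Ls^T by rewrite ME !mulmxA LR mul1mx.
have MR0 : M *m R0 = 0 by rewrite ME -mulmxA LR0 mulmx0.
(* With D the diagonal matrix of [d], D Ls^T J R0 = Ls^T M J R0 = - Ls^T J M R0 = 0, and D has
   nonzero diagonal entries. *)
have LJR0 : Ls^T *m J *m R0 = 0.
  have : diag_mx d *m (Ls^T *m J *m R0) = 0.
    rewrite !mulmxA -LM -(mulmxA _ M) -[M *m J]opprK -JM mulmxN mulNmx.
    by rewrite -!mulmxA MR0 !mulmx0 oppr0.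
  move=> /matrixP dL; apply/matrixP => i j; move: (dL i j).
  rewrite mul_diag_mx mxE [RHS]mxE => /eqP.
  by rewrite mulf_eq0 (negPf (d0 i)) [RHS]mxE => /eqP.
have LsJ : Ls = J *m colsub (@swap_ord s) Ls.
  apply: trmx_inj; rewrite trmx_mul trmx_mxsub tr_flip_mx -/J.
  (* As [row_mx Rs R0] is invertible, it suffices to compare the products with it; both equal (1
     0). *)
  suff /(congr1 (mulmx^~ (row_mx Ls L0)^T)) :
      Ls^T *m row_mx Rs R0 = rowsub (@swap_ord s) Ls^T *m J *m row_mx Rs R0.
    by rewrite -!mulmxA PQ !mulmx1.
  rewrite !mul_mx_row LR LR0; congr row_mx.
    (* [J] swaps the columns of [Rs] within pairs, so this block is the identity with rows and
       columns permuted alike, hence the identity. *)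
    rewrite -mulmxA RsE flip_paired_cols -RsE -mxsub_mul LR.
    apply/matrixP => i j; rewrite !mxE.
    by rewrite (inj_eq (inv_inj (@swap_ordK s))).
  rewrite -mulmxA mul_rowsub_mx mulmxA LJR0.
  by apply/matrixP => i j; rewrite !mxE.
have colF j : col (pair_ord false j) Ls = col_mx (col j Lo) (col j Le).
  by rewrite -col_first_cols LsE col_col_mx.
apply: eq_col_pair_ord => -[] j; rewrite col_interleave col_col_mx //.
(* Only the second column of each pair remains; by [LsJ] it is the flip of the first. *)
rewrite LsJ colE -mulmxA -colE.
rewrite [X in J *m X](_ : _ = col (swap_ord (pair_ord true j)) Ls); last first.
  by apply/matrixP => i l; rewrite !mxE.
by rewrite swap_pair_ord colF flip_mx_col linearN.
Qed.

(** * Recombination of the modes into cosh and sinh *)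

Lemma diag_mul_sum (R : realType) (m n p q : nat) (A : 'M[R]_(m, n))
    (e : 'rV[R]_n) (B : 'M[R]_(p, n)) (w : 'M[R]_(p, q)) :
  A *m (diag_mx e *m (B^T *m w))
  = \sum_k e 0 k *: (col k A *m ((col k B)^T *m w)).
Proof.
apply/matrixP => i j; rewrite mxE summxE; apply: eq_bigr => k _.
rewrite mul_diag_mx mxE [RHS]mxE [X in _ = _ * X]mxE big_ord1 !mxE mulrCA.
by congr (_ * (_ * _)); apply: eq_bigr => l _; rewrite !mxE.
Qed.

(** Meant for p = exp(mu x) and q = exp(- mu x): then p + q = 2 cosh(mu x) and p - q = 2 sinh(mu x),
    the latter collecting the products that mix the [o] and [e] parts. *)
Lemma paired_term (R : realType) (r : nat) (ro re lo le wo we : 'cV[R]_r)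
    (p q : R) :
  p *: (col_mx ro re *m ((col_mx lo le)^T *m col_mx wo we))
    + q *: (col_mx (- ro) re *m ((col_mx (- lo) le)^T *m col_mx wo we))
  = (p + q) *: col_mx (ro *m (lo^T *m wo)) (re *m (le^T *m we))
    + (p - q) *: col_mx (ro *m (le^T *m we)) (re *m (lo^T *m wo)).
Proof.
rewrite !tr_col_mx !mul_row_col linearN /= mulNmx.
move: (lo^T *m wo) (le^T *m we) => X Y.
rewrite !mul_col_mx !mulNmx !mulmxDr !mulmxN !scale_col_mx !add_col_mx.
by congr col_mx; apply/matrixP => i j; rewrite !mxE; ring.
Qed.

Lemma signed_pairsD (R : realType) (s r : nat) (mu : nat -> R) :
  (s <= r)%N -> (forall j, (s <= j < r)%N -> mu j = 0) ->
  signed_pairs (s.*2 + (r - s).*2) mu = row_mx (signed_pairs s.*2 mu) 0.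
Proof.
move=> sr mu0; apply/matrixP => i k; rewrite ord1 {i}.
case: (split_ordP k) => l ->; rewrite ?row_mxEl ?row_mxEr !mxE //=.
(* An index in the right block is [s.*2 + l]; its half [s + l./2] lies in [s, r), where [mu]
   vanishes. *)
rewrite mu0 ?mulr0 // halfD odd_double andFb add0n doubleK leq_addr /=.
by rewrite -ltn_subRL ltn_half_double.
Qed.

Lemma signed_pairs_pair_ord (R : realType) (s : nat) (mu : nat -> R) (b : bool)
    (j : 'I_s) :
  signed_pairs s.*2 mu 0 (pair_ord b j) = (-1) ^+ b * mu j.
Proof.
rewrite mxE -signr_odd odd_pair_ord.
by rewrite -[_./2]/(nat_of_ord (half_ord _)) half_pair_ord.
Qed.

Theorem mainTheorem3 (R : realType) (m n r s : nat)
    (Aoe : 'M[R]_(m, n)) (rankA : \rank Aoe = r)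
    (U1 : 'M[R]_(m, r)) (U2 : 'M[R]_(m, m - r)) (lambda : 'rV[R]_r)
    (V1 : 'M[R]_(n, r)) (V2 : 'M[R]_(n, n - r))
    (svdA : svd Aoe U1 U2 lambda V1 V2)
    (Loo : 'M[R]_m) (Lee : 'M[R]_n)
    (Loo_nsd : neg_semidef Loo) (Lee_nsd : neg_semidef Lee)
    (Loo_unit : U2^T *m Loo *m U2 \in unitmx)
    (Lee_unit : V2^T *m Lee *m V2 \in unitmx)
    (s_gt0 : (0 < s)%N) (s_le_r : (s <= r)%N)
    (mu : nat -> R)
    (mu_dec : forall i j : nat, (i <= j)%N -> (j < r)%N -> mu j <= mu i)
    (mu_gt0 : forall j : nat, (j < s)%N -> 0 < mu j)
    (mu_eq0 : forall j : nat, (s <= j)%N -> (j < r)%N -> mu j = 0)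
    (Rs Ls : 'M[R]_(r + r, s.*2)) (R0 L0 : 'M[R]_(r + r, (r - s).*2))
    (Ro Re Lo Le : 'M[R]_(r, s))
    (RsE : Rs = paired_cols Ro Re)
    (LrE : inverse_mx (row_mx Rs R0) (row_mx Ls L0)^T)
    (LoLeE : first_cols Ls = col_mx Lo Le)
    (eigen_decomp :
      ode_mx lambda (tilde_mx Loo U1 U2) (tilde_mx Lee V1 V2)
      = row_mx Rs R0 *m diag_mx (signed_pairs (s.*2 + (r - s).*2) mu)
          *m (row_mx Ls L0)^T)
    (vo ve : R -> 'cV[R]_r)
    (v_sol : linear_ode_solution
      (ode_mx lambda (tilde_mx Loo U1 U2) (tilde_mx Lee V1 V2)) 0 1
      (fun x => col_mx (vo x) (ve x))) :
  let v := fun x : R => col_mx (vo x) (ve x) in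
  let j1 : 'I_s := Ordinal s_gt0 in
  let Ct := cosh_term mu Ro Re Lo Le (vo 0) (ve 0) in
  let St := sinh_term mu Ro Re Lo Le (vo 0) (ve 0) in
  [/\ Ls = paired_cols Lo Le,
      (forall x : R, x \in `[0, 1] ->
         v x = \sum_(j < s) (Ct j x + St j x) + R0 *m L0^T *m v 0) &
      ((col j1 Lo)^T *m vo 0 = 0 -> (col j1 Lo)^T *m vo 1 = 0 ->
       [/\ (col j1 Le)^T *m ve 0 = 0,
           (col j1 Le)^T *m ve 1 = 0,
           (forall x : R, x \in `[0, 1] -> Ct j1 x = 0 /\ St j1 x = 0) &
           (forall x : R, x \in `[0, 1] ->
              v x = \sum_(j < s | j != j1) (Ct j x + St j x)
                    + R0 *m L0^T *m v 0)])].
Proof.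
move=> v j1 Ct St.
set M := ode_mx _ _ _ in eigen_decomp v_sol.
pose d := signed_pairs s.*2 mu.
have d0 k : d 0 k != 0.
  rewrite -(pair_ord_half k) signed_pairs_pair_ord.
  by rewrite mulf_neq0 ?signr_eq0 ?gt_eqF ?mu_gt0.
rewrite signed_pairsD in eigen_decomp => //; last first.
  by move=> j /andP[]; exact: mu_eq0.
(* The zero eigenvalues remove the contribution of [R0] and [L0]. *)
have ME : M = Rs *m diag_mx d *m Ls^T.
  rewrite eigen_decomp diag_mx_row tr_row_mx mul_row_block mul_row_col.
  by rewrite !mulmx0 add0r addr0 linear0 mulmx0 mul0mx addr0.
have expdE x (b : bool) j : map_mx (fun c => expR (c * x)) d 0 (pair_ord b j)
    = expR ((-1) ^+ b * mu j * x).
  by rewrite mxE signed_pairs_pair_ord.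
have [PQ QP] := LrE.
have LsE : Ls = paired_cols Lo Le.
  exact: (paired_cols_dual LrE d0 ME (flip_mx_antidiag _ _) RsE LoLeE).
have modes x (x01 : x \in `[0, 1]) :
    Ls^T *m v x = diag_mx (map_mx (fun c => expR (c * x)) d) *m (Ls^T *m v 0)
    /\ L0^T *m v x = L0^T *m v 0.
  have := diag_linear_ode_solution QP eigen_decomp v_sol x01.
  rewrite tr_row_mx map_row_mx diag_mx_row !(mul_col_mx Ls^T) mul_block_col !mul0mx.
  rewrite addr0 add0r subr0 => /eq_col_mx[-> ->]; split=> //.
  (* The coordinates along [R0] are constant, since exp(0 x) = 1. *)
  rewrite [X in diag_mx X](_ : _ = const_mx 1) ?diag_const_mx ?mul1mx //.
  by apply/matrixP => i j; rewrite !mxE mul0r expR0.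
have vE x (x01 : x \in `[0, 1]) :
    v x = \sum_(j < s) (Ct j x + St j x) + R0 *m L0^T *m v 0.
  (* Resolution of the identity: v = Rs Ls^T v + R0 L0^T v. *)
  rewrite -[LHS]mul1mx -PQ tr_row_mx mul_row_col mulmxDl -!mulmxA.
  have [-> ->] := modes x x01; congr (_ + _).
  rewrite diag_mul_sum sum_pair_ord; apply: eq_bigr => j _.
  rewrite RsE LsE !col_interleave !expdE expr0 expr1 mul1r.
  rewrite !col_col_mx !linearN /= paired_term /Ct /St /cosh_term /sinh_term.
  rewrite /cosh /sinh mulN1r mulNr.
  by congr (_ *: _ + _ *: _); field.
split=> // lo0 lo1.
have mode (x : R) (b : bool) (x01 : x \in `[0, 1])
    (lox : (col j1 Lo)^T *m vo x = 0) :
    (col j1 Le)^T *m ve x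
    = expR ((-1) ^+ b * mu j1 * x) *: ((col j1 Le)^T *m ve 0).
  have [/(congr1 (row (pair_ord b j1))) + _] := modes x x01.
  rewrite row_mul [RHS]row_mul row_diag_mx -scalemxAl -rowE row_mul.
  rewrite expdE -tr_col LsE col_interleave.
  (* The two left eigenvectors of a pair differ only in the sign of the [o] part, which contributes
     nothing here. *)
  have lv (y : R) : (col j1 Lo)^T *m vo y = 0 ->
      (col j1 (if b then col_mx (- Lo) Le else col_mx Lo Le))^T *m v y
      = (col j1 Le)^T *m ve y.
    move=> loy; rewrite /v; case: b; rewrite col_col_mx tr_col_mx mul_row_col.
      by rewrite !linearN /= mulNmx loy oppr0 add0r.
    by rewrite loy add0r.
  by rewrite !lv.
have in1 : (1 : R) \in `[0, 1] by rewrite in_itv /= ler01 lexx.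
have le0 : (col j1 Le)^T *m ve 0 = 0.
  have := mode 1 true in1 lo1; rewrite (mode 1 false in1 lo1) expr0 expr1.
  move=> /eqP; rewrite -subr_eq0 -scalerBl scaler_eq0 => /orP[|/eqP//].
  (* Otherwise exp(mu 0) = exp(- mu 0), so that twice [mu 0] is zero, against [mu_gt0]. *)
  rewrite subr_eq0 => /eqP/expR_inj /eqP.
  rewrite mul1r mulN1r !mulr1 -subr_eq0 opprK -mulr2n mulrn_eq0 /=.
  by rewrite gt_eqF ?mu_gt0.
have CS0 x : Ct j1 x = 0 /\ St j1 x = 0.
  by rewrite /Ct /St /cosh_term /sinh_term lo0 le0 !mulmx0 col_mx0 !scaler0.
split=> //.
- by rewrite (mode 1 false) // le0 scaler0.
- by move=> x x01; rewrite vE // (bigD1 j1) //= (CS0 x).1 (CS0 x).2 !add0r.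
Qed.
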